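(* For every integer $d \ge 1$ there exists an acute set in $\mathbb{R}^d$ of size $F_{d+1}$; that is, $f(d) \ge F_{d+1}$.
   Context: A set of points in $\mathbb{R}^d$ is called acute if any three distinct points of the set form an acute triangle, i.e. for any three distinct points $x,y,z$ of the set all three angles of the triangle $xyz$ are strictly less than $\pi/2$ (equivalently, $\langle y-x, z-x\rangle > 0$ for all choices of three distinct points $x,y,z$ in the set). Sets with fewer than three points are acute vacuously. $f(d)$ denotes the maximum size of an acute set in $\mathbb{R}^d$ (this maximum is known to be finite). $F_d$ denotes the $d$-th Fibonacci number with the indexing $F_0 = F_1 = 1$ and $F_{d+2} = F_{d+1} + F_d$ for $d \ge 0$. *)

(* Defs.v *)
From HB Require Import structures.
From mathcomp Require Import all_boot all_order all_algebra.
From mathcomp Require Import all_classical all_reals all_analysis.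

Set Implicit Arguments.
Unset Strict Implicit.
Unset Printing Implicit Defensive.

Import Order.TTheory GRing.Theory Num.Theory.
Local Open Scope classical_set_scope.
Local Open Scope card_scope.
Local Open Scope ring_scope.

Definition dot (R : realType) (d : nat) (u v : 'rV[R]_d) : R :=
  \sum_(i < d) u 0 i * v 0 i.

(* The library norm `|u| on 'rV[R]_d is the sup norm, hence this one. *)
Definition enorm (R : realType) (d : nat) (u : 'rV[R]_d) : R :=
  Num.sqrt (dot u u).

(* The angle at the vertex x; meaningful when y and z differ from x. *)
Definition angle (R : realType) (d : nat) (x y z : 'rV[R]_d) : R :=
  acos (dot (y - x) (z - x) / (enorm (y - x) * enorm (z - x))).

(* Three distinct collinear points have an angle pi, so they are not acute. *)
Definition acute_triangle (R : realType) (d : nat) (x y z : 'rV[R]_d) : Prop :=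
  [/\ angle x y z < pi / 2, angle y z x < pi / 2 & angle z x y < pi / 2].

Definition acute (R : realType) (d : nat) (A : set 'rV[R]_d) : Prop :=
  forall x y z : 'rV[R]_d, A x -> A y -> A z ->
    x <> y -> y <> z -> x <> z -> acute_triangle x y z.

(* The maximum size f(d) of an acute set, taken as a supremum in \bar R so that
   its definition does not presuppose that the sizes are bounded. *)
Definition max_acute_size (R : realType) (d : nat) : \bar R :=
  ereal_sup [set (n%:R)%:E | n in
    [set n : nat | exists A : set 'rV[R]_d, acute A /\ A #= `I_n]].

Fixpoint fib (n : nat) : nat :=
  match n with
  | 0 => 1
  | m.+1 => match m with
            | 0 => 1
            | k.+1 => fib m + fib k
            end
  end%N.

(* Main.v *)
Require Import Defs.
From mathcomp Require Import all_boot all_order all_algebra.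
From mathcomp Require Import all_classical all_reals all_analysis.
From mathcomp Require Import ring lra.

(** The construction is an induction on the dimension that doubles some of the
    points.  Suppose that X is an acute set in R^(n+1), cut as X = A u B with A
    in the hyperplane of height 0 and all of B strictly above it, where
    |A| = fib n.+1 and |B| = fib n.  Put X in the hyperplane of height 0 of
    R^(n+2) and give each a_i in A a companion

      a_i + e v_i,   v_i = (1 - 2 m_i^2 e^4,  2 m_i e^2,  e^6 w_i),

    whose coordinates are the new height, the height in R^(n+1), and the
    remaining n coordinates; the m_i > 0 are distinct.  The companions lie
    strictly above X, so X and the companions play the parts of A and B one
    dimension higher, and their numbers fib n.+2 and fib n.+1 are again
    consecutive.

    For small e > 0 the new set is acute.  If the vertex of an angle is close to
    neither of the two other points, the angle is close to an angle of X, or to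
    0 when those two points are an a_i and its companion.  Otherwise the angle
    is between a segment [a_i, a_i + e v_i] and a further point z, and it is
    acute at both ends when z projects orthogonally strictly inside that segment.
    - At the end a_i, the product of v_i and z - a_i has to be positive.  It is
      close to e if z is the companion of some a_k: then v_i . v_k is close to 1
      and v_i . (a_k - a_i) is far smaller than e.  If z is in B, it is positive
      because B lies above A and m_i > 0.  If z is in A, only w_i contributes,
      and w_i is chosen to have a positive product with every a_k - a_i.
    - At the end a_i + e v_i, the product of v_i and e v_i - (z - a_i) has to be
      positive.  If z is in X, it is close to e, since v_i is orthogonal to the
      hyperplane of X up to O(e^2) and has length close to 1.  If z is the
      companion of a_k, it is e v_i . (v_i - v_k) up to a far smaller
      contribution of w_i; and v_i . (v_i - v_k) > 0, because v_i and v_k have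
      length 1 up to O(e^8) and are at distance about 2 |m_i - m_k| e^2.
    The powers of e separate these scales, so that each inner product is a
    polynomial in e whose lowest coefficient is positive.  The
    three kinds of angles are treated in [angle_distinct_bases], [angle_at_old]
    and [angle_at_new]. *)

Import Order.TTheory GRing.Theory Num.Theory.
Import numFieldNormedType.Exports.
Local Open Scope classical_set_scope.
Local Open Scope card_scope.
Local Open Scope ring_scope.

(** * The inner product *)

Section Dot.
Context {R : realType} {d : nat}.
Implicit Types (u v w : 'rV[R]_d) (k : R).

Lemma dotC u v : dot u v = dot v u.
Proof. by apply: eq_bigr => i _; rewrite mulrC. Qed.

Lemma dotDl u v w : dot (u + v) w = dot u w + dot v w.
Proof. by rewrite -big_split; apply: eq_bigr => i _; rewrite mxE mulrDl. Qed.

Lemma dotZl k u v : dot (k *: u) v = k * dot u v.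
Proof. by rewrite mulr_sumr; apply: eq_bigr => i _; rewrite mxE mulrA. Qed.

Lemma dotNl u v : dot (- u) v = - dot u v.
Proof. by rewrite -scaleN1r dotZl mulN1r. Qed.

Lemma dot0l v : dot 0 v = 0.
Proof. by rewrite -(scale0r v) dotZl mul0r. Qed.

Lemma dotDr u v w : dot u (v + w) = dot u v + dot u w.
Proof. by rewrite dotC dotDl !(dotC u). Qed.

Lemma dotZr k u v : dot u (k *: v) = k * dot u v.
Proof. by rewrite dotC dotZl dotC. Qed.

Lemma dotNr u v : dot u (- v) = - dot u v.
Proof. by rewrite dotC dotNl dotC. Qed.

Lemma dot_suml (I : finType) (f : I -> 'rV[R]_d) v :
  dot (\sum_i f i) v = \sum_i dot (f i) v.
Proof.
by apply: (big_morph (fun u => dot u v)) => [u w|]; rewrite ?dotDl ?dot0l.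
Qed.

Lemma dot_cvg (F : set_system R) (FF : Filter F) (f g : R -> 'rV[R]_d) u v :
  (forall i, f e 0 i @[e --> F] --> u 0 i) ->
  (forall i, g e 0 i @[e --> F] --> v 0 i) ->
  dot (f e) (g e) @[e --> F] --> dot u v.
Proof.
move=> fu gv; apply: cvg_big => [|i _]; last exact: cvgM.
exact: add_continuous.
Qed.

End Dot.

(** * Adding a coordinate *)

Section Raise.
Context {R : realType}.

Definition raise {d} (t : R) (u : 'rV[R]_d) : 'rV[R]_d.+1 :=
  \row_j oapp (u 0) t (unlift ord0 j).

Lemma raise0 d t (u : 'rV[R]_d) : raise t u 0 ord0 = t.
Proof. by rewrite mxE unlift_none. Qed.

Lemma raiseS d t (u : 'rV[R]_d) i : raise t u 0 (lift ord0 i) = u 0 i.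
Proof. by rewrite mxE liftK. Qed.

Lemma raiseB d t s (u v : 'rV[R]_d) :
  raise t u - raise s v = raise (t - s) (u - v).
Proof.
apply/rowP => j; rewrite [LHS]mxE [X in _ + X]mxE.
by case: (unliftP ord0 j) => [i|] ->; rewrite ?raise0 // !raiseS !mxE.
Qed.

Lemma dot_raise d t s (u v : 'rV[R]_d) :
  dot (raise t u) (raise s v) = t * s + dot u v.
Proof.
rewrite /dot big_ord_recl !raise0; congr (_ + _).
by apply: eq_bigr => i _; rewrite !raiseS.
Qed.

Lemma raise_cvg d (F : set_system R) (FF : Filter F) (t : R -> R)
    (f : R -> 'rV[R]_d) (s : R) (u : 'rV[R]_d) :
  t e @[e --> F] --> s -> (forall i, f e 0 i @[e --> F] --> u 0 i) ->
  forall j, raise (t e) (f e) 0 j @[e --> F] --> raise s u 0 j.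
Proof.
move=> ts fu j; case: (unliftP ord0 j) => [i|] ->.
  by rewrite raiseS; under eq_cvg do rewrite raiseS; exact: fu.
by rewrite raise0; under eq_cvg do rewrite raise0.
Qed.

End Raise.

(** * Acute angles and small parameters *)

(** For [x] above 1 the inverse cosine has the default value 0, which is also
    below pi / 2; hence the positivity of an inner product is enough to make an
    angle acute, without the Cauchy-Schwarz inequality. *)
Lemma acos_lt_pihalf (R : realType) (x : R) : 0 < x -> acos x < pi / 2.
Proof.
move=> x0; rewrite unlock; case: xgetP => [y _ [yB yx]|_]; last first.
  by rewrite divr_gt0 // pi_gt0.
have pi0 := pi_gt0 R.
by rewrite -ltr_cos ?cos_pihalf ?yx // in_itv /= ?yB //; apply/andP; split; lra.
Qed.

(** A polynomial with a positive lowest coefficient [l] is positive just to the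
    right of 0.  All comparisons between the scales of the construction reduce
    to this. *)
Lemma near0_lead_gt0 (R : realType) n (l : R) (q : {poly R}) (f : R -> R) :
  (forall e, f e = e ^+ n * (l + e * q.[e])) -> 0 < l ->
  \forall e \near 0^'+, 0 < f e.
Proof.
move=> fE l0; pose p := l%:P + 'X * q.
have pE e : p.[e] = l + e * q.[e] by rewrite !hornerE.
have ppos : \forall e \near 0^'+, 0 < p.[e].
  apply: (cvgr_gt p.[0]); last by rewrite pE mul0r addr0.
  by apply: cvg_at_right_filter; exact: continuous_horner.
near=> e; rewrite fE mulr_gt0 ?exprn_gt0 // -pE; by near: e.
Unshelve. all: by end_near. Qed.

Lemma horner_cvg0 (R : realType) (q : {poly R}) (f : R -> R) l :
  f =1 horner q -> q.[0] = l -> f e @[e --> 0^'+] --> l.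
Proof.
move=> /funext -> <-; apply: cvg_at_right_filter; exact: continuous_horner.
Qed.

(** * Acute families *)

Section Families.
Context {R : realType}.

(** The points [y] and [z] may coincide.  This case says that [p] is injective
    and saves a separate treatment of it. *)
Definition acute_family {d} {I : Type} (p : I -> 'rV[R]_d) :=
  forall x y z, y <> x -> z <> x -> 0 < dot (p y - p x) (p z - p x).

Lemma acute_family_inj {d} {I : Type} {p : I -> 'rV[R]_d} :
  acute_family p -> injective p.
Proof.
move=> pA x y pxy; apply: contrapT => xy.
by have := pA x y y (nesym xy) (nesym xy); rewrite pxy subrr dot0l ltxx.
Qed.

Lemma acute_range d (I : Type) (p : I -> 'rV[R]_d) :
  acute_family p -> acute (range p).
Proof.
move=> pA; have angle_lt x y z : y <> x -> z <> x ->
    angle (p x) (p y) (p z) < pi / 2.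
  move=> yx zx; apply: acos_lt_pihalf.
  by rewrite divr_gt0 ?mulr_gt0 ?sqrtr_gt0 //; apply: pA.
by move=> _ _ _ [x _ <-] [y _ <-] [z _ <-] xy yz xz; split; apply: angle_lt;
  congruence.
Qed.

(** Take for [w i] the sum of all [p l - p i]: every term has a nonnegative
    product with [p k - p i], and the term of [k] a positive one. *)
Lemma inward_direction {d} {I : finType} {p : I -> 'rV[R]_d} :
  acute_family p ->
  exists w : I -> 'rV[R]_d, forall i k, k <> i -> 0 < dot (w i) (p k - p i).
Proof.
move=> pA; exists (fun i => \sum_l (p l - p i)) => i k ki.
rewrite dot_suml (bigD1 k) //= ltr_pwDl ?pA // sumr_ge0 // => l _.
case: (eqVneq l i) => [->|/eqP li]; first by rewrite subrr dot0l.
by rewrite ltW // pA.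
Qed.

(** The shape of the sets in the induction: the points of [a], in the hyperplane
    of height 0, are those that receive companions. *)
Definition glue {d} {I J : Type} (a : I -> 'rV[R]_d)
    (t : J -> R) (c : J -> 'rV[R]_d) (k : I + J) : 'rV[R]_d.+1 :=
  match k with inl i => raise 0 (a i) | inr j => raise (t j) (c j) end.

Lemma glue_acute_base {d} {I J : Type} {a : I -> 'rV[R]_d}
    {t : J -> R} {c : J -> 'rV[R]_d} :
  acute_family (glue a t c) -> acute_family a.
Proof.
move=> pA x y z yx zx.
have := pA (inl x) (inl y) (inl z).
rewrite /= !raiseB dot_raise subrr mul0r add0r; apply; congruence.
Qed.

(** * Doubling the points of height 0 *)

Section Doubling.
Context {d : nat} {I J : finType} {a : I -> 'rV[R]_d}.
Context {t : J -> R} {c : J -> 'rV[R]_d}.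
Hypothesis t_gt0 : forall j, 0 < t j.
Hypothesis X_acute : acute_family (glue a t c).
Context {w : I -> 'rV[R]_d} {m : I -> R}.
Hypothesis w_in : forall i k, k <> i -> 0 < dot (w i) (a k - a i).
Hypothesis m_gt0 : forall i, 0 < m i.
Hypothesis m_inj : injective m.

(* The companion of [a i] is at height [height i e] over the point [foot i e].
   The coefficients 2 make (1 - 2 m^2 e^4, 2 m e^2) a unit vector up to O(e^8). *)
Let height i e : R := e * (1 - 2 * m i ^+ 2 * e ^+ 4).
Let foot i e : 'rV[R]_d.+1 := raise (2 * m i * e ^+ 3) (a i + e ^+ 7 *: w i).
Let P e := glue (glue a t c) (height ^~ e) (foot ^~ e).
(* The position in the old family from which a point starts at e = 0. *)
Let base (x : (I + J) + I) : I + J :=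
  match x with inl k => k | inr i => inl i end.

Let expandE :=
  (hornerD, hornerN, hornerM, hornerXn, hornerX, hornerC,
   @raiseB R, @dot_raise R,
   @dotDl R, @dotDr R, @dotNl R, @dotNr R, @dotZl R, @dotZr R).

Lemma angle_comm (x y z : (I + J) + I) :
  (\forall e \near 0^'+, 0 < dot (P e y - P e x) (P e z - P e x)) ->
  \forall e \near 0^'+, 0 < dot (P e z - P e x) (P e y - P e x).
Proof. by apply: filterS => e; rewrite dotC. Qed.

Lemma P_cvg x j : P e x 0 j @[e --> 0^'+] --> raise 0 (glue a t c (base x)) 0 j.
Proof.
case: x => [k|i] /=; first exact: cvg_cst.
apply: raise_cvg => [|{}j].
  apply: (horner_cvg0 _ ('X * (1 - (2 * m i ^+ 2)%:P * 'X^4))) => [e|].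
    by rewrite /height !hornerE /=; ring.
  by rewrite !hornerE /=.
apply: raise_cvg => [|{}j].
  apply: (horner_cvg0 _ ((2 * m i)%:P * 'X^3)) => [e|].
    by rewrite !hornerE /=; ring.
  by rewrite !hornerE ?expr0n /= ?mulr0.
apply: (horner_cvg0 _ ((a i 0 j)%:P + 'X^7 * (w i 0 j)%:P)) => [e|].
  by rewrite !hornerE /= !mxE; ring.
by rewrite !hornerE ?expr0n /= ?mul0r ?addr0.
Qed.

(** At e = 0 the inner product is the one of the old points, which is positive;
    it varies continuously with e. *)
Lemma angle_distinct_bases x y z : base y <> base x -> base z <> base x ->
  \forall e \near 0^'+, 0 < dot (P e y - P e x) (P e z - P e x).
Proof.
move=> yx zx; pose Q x := raise 0 (glue a t c (base x)).
have lim u v j : (P e u - P e v) 0 j @[e --> 0^'+] --> (Q u - Q v) 0 j.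
  have subE (f g : 'rV[R]_d.+2) : (f - g) 0 j = f 0 j - g 0 j by rewrite !mxE.
  by rewrite subE; under eq_cvg do rewrite subE; apply: cvgB; exact: P_cvg.
apply: (cvgr_gt (dot (Q y - Q x) (Q z - Q x))).
  by apply: dot_cvg => j; exact: lim.
by rewrite !raiseB dot_raise subrr mul0r add0r X_acute.
Qed.

(** The leading term comes from [w i] if [z] is another point of height 0, from
    the height [t j] of [z] over the points of [a] if [z] is one of the other
    old points, and from the new heights of both points if [z] is a companion. *)
Lemma angle_at_old i z : z <> inl (inl i) ->
  \forall e \near 0^'+,
    0 < dot (P e (inr i) - P e (inl (inl i))) (P e z - P e (inl (inl i))).
Proof.
case: z => [[k|j]|k] zi; rewrite /P /=.
- have ki : k <> i by congruence.
  apply: (near0_lead_gt0 _ 7 (dot (w i) (a k - a i)) 0) => [e|]; last exact: w_in.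
    rewrite !expandE; ring.
- apply: (near0_lead_gt0 _ 3 (2 * m i * t j)
    ('X^3 * (dot (w i) (c j - a i))%:P)) => [e|]; last by rewrite !mulr_gt0.
    rewrite !expandE; ring.
- apply: (near0_lead_gt0 _ 2 1
    ((4 * m i * m k - 2 * m i ^+ 2 - 2 * m k ^+ 2)%:P * 'X^3
     + (4 * m i ^+ 2 * m k ^+ 2)%:P * 'X^7
     + (dot (w i) (a k - a i))%:P * 'X^4 + (dot (w i) (w k))%:P * 'X^11)) => [e|].
    rewrite !expandE /height; ring.
  exact: ltr01.
Qed.

(** For an old point [z] the squared length of the segment, of order e^2,
    dominates.  For a companion it is cancelled up to the product of one direction
    with its difference from the other; between nearly unit vectors this is
    about half the square of their distance, 2 e^4 (m k - m i)^2. *)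
Lemma angle_at_new i z : z <> inr i ->
  \forall e \near 0^'+,
    0 < dot (P e (inl (inl i)) - P e (inr i)) (P e z - P e (inr i)).
Proof.
case: z => [k|k] zi; rewrite /P /=.
- have [T [C ->]] : exists T C, glue a t c k = raise T C.
    by case: k {zi} => k; [exists 0, (a k) | exists (t k), (c k)].
  apply: (near0_lead_gt0 _ 2 1
    ((- 2 * m i * T)%:P + (4 * m i ^+ 4)%:P * 'X^7
     - (dot (w i) (C - a i))%:P * 'X^4 + (dot (w i) (w i))%:P * 'X^11)) => [e|].
    rewrite !expandE (dotC (a i) (w i)) /height; ring.
  exact: ltr01.
- have mki : 0 < (m k - m i) ^+ 2.
    by rewrite exprn_even_gt0 //= subr_eq0; apply/eqP => /m_inj; congruence.
  apply: (near0_lead_gt0 _ 6 (2 * (m k - m i) ^+ 2)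
    (- (dot (w i) (a k - a i))%:P
     - (4 * m i ^+ 2 * (m k ^+ 2 - m i ^+ 2))%:P * 'X^3
     - (dot (w i) (w k - w i))%:P * 'X^7)) => [e|]; last by rewrite mulr_gt0.
    rewrite !expandE (dotC (a i) (w i)) /height; ring.
Qed.

Lemma angle_same_base x y z : y <> x -> z <> x -> base y = base x ->
  \forall e \near 0^'+, 0 < dot (P e y - P e x) (P e z - P e x).
Proof.
case: x y => [x|i] [y|k] yx zx /= byx; try by case: yx; congruence.
- by rewrite -byx in zx *; exact: angle_at_old.
- by rewrite byx; exact: angle_at_new.
Qed.

Lemma doubling_acute : \forall e \near 0^'+, acute_family (P e).
Proof.
apply: filter_forall => x; apply: filter_forall => y; apply: filter_forall => z.
have [->|/eqP yx] := eqVneq y x; first exact: nearW.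
have [->|/eqP zx] := eqVneq z x; first exact: nearW.
apply: filterS (_ : \forall e \near 0^'+,
  0 < dot (P e y - P e x) (P e z - P e x)) => [e H _ _ //|].
have [byx|/eqP byx] := eqVneq (base y) (base x); first exact: angle_same_base.
have [bzx|/eqP bzx] := eqVneq (base z) (base x).
  by apply: angle_comm; exact: angle_same_base.
exact: angle_distinct_bases.
Qed.

Lemma height_gt0 : \forall e \near 0^'+, forall i, 0 < height i e.
Proof.
apply: filter_forall => i.
apply: (near0_lead_gt0 _ 1 1 ((- 2 * m i ^+ 2)%:P * 'X^3)) => [e|].
  by rewrite /height hornerM hornerXn hornerC; ring.
exact: ltr01.
Qed.

End Doubling.

Lemma doubling {d} {I J : finType} {a : I -> 'rV[R]_d}
    {t : J -> R} {c : J -> 'rV[R]_d} :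
  (forall j, 0 < t j) -> acute_family (glue a t c) ->
  exists (s : I -> R) (g : I -> 'rV[R]_d.+1),
    (forall i, 0 < s i) /\ acute_family (glue (glue a t c) s g).
Proof.
move=> t0 XA; have [w w_in] := inward_direction (glue_acute_base XA).
pose m (i : I) : R := (enum_rank i).+1%:R.
have m_inj : injective m.
  by move=> i k /eqP; rewrite eqr_nat => /eqP [] /ord_inj /enum_rank_inj.
have m_gt0 i : 0 < m i by rewrite ltr0n.
have [e [h0 PA]] := filter_ex (filterI (height_gt0 (m := m))
  (doubling_acute t0 XA w_in m_gt0 m_inj)).
by eexists; eexists; split; [exact: h0|exact: PA].
Qed.

(** The induction starts with the two points 0 and 1 of the line. *)
Lemma fib_family n : exists (I J : finType) (a : I -> 'rV[R]_n) (t : J -> R)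
    (c : J -> 'rV[R]_n),
  [/\ #|I| = fib n.+1, #|J| = fib n, forall j, 0 < t j
    & acute_family (glue a t c)].
Proof.
elim: n => [|n [I [J [a [t [c [cI cJ t0 XA]]]]]]].
  exists unit, unit, (fun=> 0), (fun=> 1), (fun=> 0).
  split=> [||//|]; rewrite ?card_unit //.
  by move=> [[]|[]] [[]|[]] [[]|[]] //= _ _;
    rewrite !raiseB dot_raise !subr0 ?sub0r ?dot0l ?mulrNN mulr1 addr0 ltr01.
have [s [g [s0 PA]]] := doubling t0 XA.
exists (I + J)%type, I, (glue a t c), s, g; split => //.
by rewrite card_sum cI cJ.
Qed.

End Families.

Theorem theorem2 (R : realType) (d : nat) (d_ge1 : (1 <= d)%N) :
  (exists A : set 'rV[R]_d, acute A /\ A #= `I_(fib d.+1)) /\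
  (((fib d.+1)%:R)%:E <= max_acute_size R d)%E.
Proof.
suff ex : exists A : set 'rV[R]_d, acute A /\ A #= `I_(fib d.+1).
  by split=> //; apply: ereal_sup_ubound; exists (fib d.+1).
case: d d_ge1 => // n _; have [I [J [a [t [c [cI cJ _ XA]]]]]] := @fib_family R n.
have cIJ : #|{: I + J}| = fib n.+2 by rewrite card_sum cI cJ.
pose p (k : 'I_(fib n.+2)) := glue a t c (enum_val (cast_ord (esym cIJ) k)).
have pA : acute_family p.
  by move=> x y z yx zx; apply: XA => /enum_val_inj /cast_ord_inj.
exists (range p); split; first exact: acute_range.
rewrite (card_eqr card_II); apply: inj_card_eq.
by move=> x y _ _ /(acute_family_inj pA).
Qed.
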